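(* For $\ell\in\{0,1\}$, every integer $n\ge0$ and every $\zeta>0$, the first-order derivative of $P_{n+1}^{(\ell)}(x;\zeta)$ with respect to the parameter $\zeta$ satisfies $$\frac{\partial P_{n+1}^{(\ell)}}{\partial\zeta}=a_n^{(\ell)}P_n^{(\ell)}-\frac12\left(G(\zeta)-\zeta^{-1}-b_{n+1}^{(\ell)}\right)P_{n+1}^{(\ell)}.$$
   Context: For $\zeta>0$ let $K_n(\zeta)=\int_0^\infty\cosh(n\vartheta)e^{-\zeta\cosh\vartheta}d\vartheta$ and $G(\zeta)=K_2(\zeta)/K_1(\zeta)$. For $\ell\in\{0,1\}$ let $\omega^{(\ell)}(x;\zeta)=K_1(\zeta)^{-1}(x^2-1)^{\ell-1/2}e^{-\zeta x}$ on $[1,\infty)$ and $(f,g)_{\omega^{(\ell)}}=\int_1^\infty f(x)g(x)\omega^{(\ell)}(x;\zeta)dx$. $\{P_n^{(\ell)}(x;\zeta)\}_{n\ge0}$ are the orthonormal polynomials in $x$ for $(\cdot,\cdot)_{\omega^{(\ell)}}$, $\deg P_n^{(\ell)}=n$, with positive leading coefficient $c_n^{(\ell)}(\zeta)$. $a_n^{(\ell)}=(xP_n^{(\ell)},P_{n+1}^{(\ell)})_{\omega^{(\ell)}}=c_n^{(\ell)}/c_{n+1}^{(\ell)}$ and $b_n^{(\ell)}=(xP_n^{(\ell)},P_n^{(\ell)})_{\omega^{(\ell)}}$. *)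

(* Defs.v *)
From HB Require Import structures.
From mathcomp Require Import all_boot all_order all_algebra.
From mathcomp Require Import all_classical all_reals all_analysis.
Import Order.TTheory GRing.Theory Num.Theory.
Import numFieldNormedType.Exports.

Set Implicit Arguments.
Unset Strict Implicit.
Unset Printing Implicit Defensive.

Local Open Scope classical_set_scope.
Local Open Scope ring_scope.

Definition cosh {R : realType} (t : R) : R := (expR t + expR (- t)) / 2.

Definition besselK {R : realType} (n : nat) (zeta : R) : R :=
  \int[lebesgue_measure]_(t in `[0, +oo[%classic)
    (cosh (n%:R * t) * expR (- (zeta * cosh t))).

Definition besselG {R : realType} (zeta : R) : R :=
  besselK 2 zeta / besselK 1 zeta.

(* For l = 0 the weight is singular at x = 1, where [powR] returns 0; this is
   a null set. *)
Definition omega {R : realType} (l : nat) (zeta x : R) : R :=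
  (besselK 1 zeta)^-1 * (x ^+ 2 - 1) `^ (l%:R - 2^-1) * expR (- (zeta * x)).

Definition inner {R : realType} (l : nat) (zeta : R) (f g : R -> R) : R :=
  \int[lebesgue_measure]_(x in `[1, +oo[%classic) (f x * g x * omega l zeta x).

(* Recall that [size p] is the degree plus one. *)
Definition orthonormal_polys {R : realType} (l : nat) (zeta : R)
    (P : nat -> {poly R}) : Prop :=
  [/\ forall n, size (P n) = n.+1,
      forall n, 0 < lead_coef (P n) &
      forall m n, inner l zeta (horner (P m)) (horner (P n)) = (m == n)%:R].

Definition coef_a {R : realType} (l : nat) (zeta : R) (P : nat -> {poly R})
    (n : nat) : R :=
  inner l zeta (fun x => x * (P n).[x]) (horner (P n.+1)).

Definition coef_b {R : realType} (l : nat) (zeta : R) (P : nat -> {poly R})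
    (n : nat) : R :=
  inner l zeta (fun x => x * (P n).[x]) (horner (P n)).

(* Main.v *)
Require Import Defs.
From HB Require Import structures.
From mathcomp Require Import all_boot all_order all_algebra.
From mathcomp Require Import all_classical all_reals all_analysis.
From mathcomp Require Import measurable_realfun ring lra.
Import Order.TTheory GRing.Theory Num.Theory.
Import numFieldNormedType.Exports.

(** Why the formula holds. Write [L z p] for the integral of the polynomial [p]
    against the weight [omega l z]. The weight depends on [z] only through
    [expR (- (z * x))] and the factor [(besselK 1 z)^-1], so
    [L' p = c z * L p - L ('X * p)] where [c] is minus the logarithmic derivative
    of K_1. An integration by parts identifies it: [c z = besselG z - z^-1].

    Let [p = P z n.+1] and let [p'] be its derivative in [z]. Differentiating
    [L (p * P_m) = (n.+1 == m)] for [m <= n.+1] gives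
      [L (p' * P_m) + L (p * P_m') + c z * (n.+1 == m) = L ('X * P_m * p)].
    For [m <= n] the second term vanishes, because [P_m'] has degree at most [m]
    and is therefore orthogonal to [p]; the right-hand side vanishes for [m < n]
    for the same reason and is [a_n] for [m = n]. For [m = n.+1] the first two
    terms are equal and the right-hand side is [b_{n+1}]. These numbers are the
    coefficients of [p'] in the orthonormal family, which is the formula
    ([is_derive_orthonormal]).

    Three facts must be in place before this computation is legitimate.
    - The coefficients of [P z n] are differentiable in [z]: by uniqueness of
      orthonormal families with positive leading coefficients, [P z n] is given
      by the Gram-Schmidt formula, built from moments and one square root of a
      positive number ([derivable_orthonormal_coef]).
    - Moments may be differentiated under the integral sign: if [g e^{-z phi}] is
      integrable for every [z > 0] and [phi >= 0], half of the exponential absorbs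
      a factor [phi], which gives a dominating function locally uniform in [z]
      ([is_derive_laplace]).
    - The integrals converge. Normalisation of [P z 0] says that the integral of
      a nonnegative function has nonzero real value, so this integral is finite
      and [besselK 1 z] is nonzero; the latter in turn makes the integral
      defining K_1 finite ([Rintegral_neq0_integrable]). All other integrals are
      controlled by these two. *)

Set Implicit Arguments.
Unset Strict Implicit.
Unset Printing Implicit Defensive.

Local Open Scope classical_set_scope.
Local Open Scope ring_scope.

(** * Differentiation of Laplace-type integrals *)

Section LaplaceIntegrals.
Context d (T : measurableType d) (R : realType) (mu : {measure set T -> \bar R}).
Variables (D : set T) (phi : T -> R).
Hypothesis mD : measurable D.
Hypothesis phi_ge0 : forall t, D t -> 0 <= phi t.
Hypothesis mphi : measurable_fun D phi.

Definition laplace_integrable (g : T -> R) : Prop := forall z, 0 < z ->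
  mu.-integrable D (EFin \o (fun t => g t * expR (- (z * phi t)))).

Lemma laplace_integrable_eq (g h : T -> R) :
  {in D, g =1 h} -> laplace_integrable g -> laplace_integrable h.
Proof.
move=> gh ig z z0; apply: eq_integrable (ig z z0) => // t Dt /=.
by rewrite gh.
Qed.

Lemma laplace_integrableZ (c : R) (g : T -> R) :
  laplace_integrable g -> laplace_integrable (fun t => c * g t).
Proof.
move=> ig z z0.
apply: eq_integrable (integrableZl mD c (ig z z0)) => // t _ /=.
by rewrite -EFinM mulrA.
Qed.

Lemma laplace_integrableD (g h : T -> R) :
  laplace_integrable g -> laplace_integrable h ->
  laplace_integrable (fun t => g t + h t).
Proof.
move=> ig ih z z0.
apply: eq_integrable (integrableD mD (ig z z0) (ih z z0)) => // t _ /=.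
by rewrite -EFinD mulrDl.
Qed.

(** Split [e^{-z phi}] into two halves: one keeps [g] integrable, the other
    absorbs [phi], since [phi * e^{-(z/2) phi} <= 2/z] by [1 + y <= e^y]. *)
Lemma laplace_integrable_phi (g : T -> R) :
  laplace_integrable g -> laplace_integrable (fun t => g t * phi t).
Proof.
move=> ig z z0.
have z20 : 0 < z / 2 by rewrite divr_gt0.
have i2 := integrableZl mD (2 / z) (integrable_norm (ig _ z20)).
apply: le_integrable i2 => //.
  have /integrableP[/measurable_EFinP m1 _] := ig z z0.
  apply/measurable_EFinP.
  have -> : (fun t => g t * phi t * expR (- (z * phi t))) =
     (fun t => g t * expR (- (z * phi t))) \* phi.
    by apply/funext => t /=; ring.
  exact: measurable_funM.
move=> t Dt /=; rewrite lee_fin.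
set e2 := expR (- (z / 2 * phi t)).
have e0 : 0 <= e2 by exact: expR_ge0.
have -> : expR (- (z * phi t)) = e2 * e2.
  by rewrite /e2 -expRD; congr expR; field.
have p0 := phi_ge0 Dt.
have H : phi t * e2 <= 2 / z.
  rewrite [leRHS](_ : _ = 2 / z * expR (z / 2 * phi t) * e2); last first.
    by rewrite -mulrA expRxMexpNx_1 mulr1.
  apply: ler_wpM2r => //.
  rewrite [leLHS](_ : _ = 2 / z * (z / 2 * phi t)); last by field; rewrite gt_eqF.
  apply: ler_wpM2l; first by rewrite divr_ge0// ltW.
  by apply: le_trans (expR_ge1Dx _); rewrite lerDr.
rewrite [leRHS]ger0_norm ?mulr_ge0 ?invr_ge0 ?(ltW z0)//.
rewrite !normrM (ger0_norm p0) (ger0_norm e0).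
have -> : `|g t| * phi t * (e2 * e2) = (phi t * e2) * (`|g t| * e2) by ring.
by apply: ler_wpM2r => //; rewrite mulr_ge0.
Qed.

(** For parameters in the interval [(z/2, 2z)] the derivative of the integrand is
    dominated by its absolute value at [z/2], integrable by
    [laplace_integrable_phi]. *)
Lemma is_derive_laplace (g : T -> R) (z : R) : 0 < z ->
  laplace_integrable g ->
  is_derive z 1 (fun s => \int[mu]_(t in D) (g t * expR (- (s * phi t))))
    (- \int[mu]_(t in D) (g t * phi t * expR (- (z * phi t)))).
Proof.
move=> z0 ig.
pose f (s : R) (t : T) := g t * expR (- (s * phi t)).
have df (s : R) (t : T) :
    is_derive s 1 (f ^~ t) (- (g t * phi t * expR (- (s * phi t)))).
  rewrite /f; apply: is_derive_eq.
  by rewrite /GRing.scale/=; ring.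
have z20 : 0 < z / 2 by rewrite divr_gt0.
have Iz : `]z / 2, 2 * z[%classic z.
  by rewrite /= in_itv/=; apply/andP; split; lra.
have Ipos s : `]z / 2, 2 * z[%classic s -> 0 < s.
  by rewrite /= in_itv/= => /andP[+ _]; apply: lt_trans.
pose G t := `|g t * phi t * expR (- (z / 2 * phi t))|.
have dE s t : partial1of2 f s t = - (g t * phi t * expR (- (s * phi t))).
  by rewrite partial1of2E derive_val.
have iphi := laplace_integrable_phi ig.
have Gub s t : `]z / 2, 2 * z[%classic s -> D t -> `|partial1of2 f s t| <= G t.
  move=> Is Dt; rewrite dE normrN /G !normrM.
  apply: ler_wpM2l => //.
  rewrite !ger0_norm ?expR_ge0// ler_expR lerN2.
  apply: ler_wpM2r; first exact: phi_ge0.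
  by move: Is; rewrite /= in_itv/= => /andP[/ltW].
have intf s : `]z / 2, 2 * z[%classic s -> mu.-integrable D (EFin \o f s).
  by move=> Is; exact: ig (Ipos _ Is).
have derf s t : `]z / 2, 2 * z[%classic s -> D t -> derivable (f ^~ t) s 1.
  by move=> _ _; case: (df s t).
have intG : mu.-integrable D (EFin \o G) by exact: integrable_norm (iphi _ z20).
have G0 t : 0 <= G t by exact: normr_ge0.
have dv := derivable_under_integral mD Iz intf derf G0 intG Gub.
apply: DeriveDef => //.
rewrite -derive1E (differentiation_under_integral mD Iz intf derf G0 intG Gub).
under eq_Rintegral do rewrite dE -mulN1r.
by rewrite RintegralZl ?mulN1r//; exact: iphi.
Qed.

End LaplaceIntegrals.

(** [Rintegral] sends infinite integrals to 0, so a nonzero value certifies that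
    the integral of a nonnegative function is finite. *)
Lemma Rintegral_neq0_integrable d (T : measurableType d) (R : realType)
    (mu : {measure set T -> \bar R}) (D : set T) (f : T -> R) :
  measurable D -> measurable_fun D f -> (forall t, D t -> 0 <= f t) ->
  \int[mu]_(t in D) f t != 0 -> mu.-integrable D (EFin \o f).
Proof.
move=> mD mf f0 If; apply/integrableP; split; first exact/measurable_EFinP.
under eq_integral.
  move=> t /set_mem Dt /=; rewrite ger0_norm ?f0//; over.
move: If; rewrite /Rintegral.
by case: (\int[mu]_(t in D) (f t)%:E)%E => [r| |] /=; rewrite ?ltry ?eqxx ?ltNye.
Qed.

(** * Hyperbolic functions *)

Definition sinh {R : realType} (t : R) : R := (expR t - expR (- t)) / 2.

Section Hyperbolic.
Context (R : realType).
Implicit Types t : R.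

Lemma is_derive_cosh t : is_derive t 1 (@cosh R) (sinh t).
Proof.
have : is_derive t 1 (fun t : R => 2^-1 * (expR t + expR (- t)))
    (2^-1 * (expR t - expR (- t))).
  by apply: is_derive_eq; rewrite /GRing.scale/=; ring.
rewrite /sinh mulrC; congr (is_derive t 1 _ _).
by apply/funext => s; rewrite /cosh mulrC.
Qed.

Lemma is_derive_sinh t : is_derive t 1 (@sinh R) (cosh t).
Proof.
have : is_derive t 1 (fun t : R => 2^-1 * (expR t - expR (- t)))
    (2^-1 * (expR t + expR (- t))).
  by apply: is_derive_eq; rewrite /GRing.scale/=; ring.
rewrite /cosh mulrC; congr (is_derive t 1 _ _).
by apply/funext => s; rewrite /sinh mulrC.
Qed.

Lemma sinh0 : sinh 0 = 0 :> R.
Proof. by rewrite /sinh oppr0 expR0 subrr mul0r. Qed.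

Lemma coshB_sinh t : cosh t - sinh t = expR (- t).
Proof. by rewrite /cosh /sinh; field. Qed.

Lemma cosh_gt0 t : 0 < cosh t.
Proof. by rewrite divr_gt0// addr_gt0// expR_gt0. Qed.

Lemma sinh_ge0 t : 0 <= t -> 0 <= sinh t.
Proof.
by move=> t0; rewrite divr_ge0// subr_ge0 ler_expR; lra.
Qed.

Lemma cosh_ge_half t : t / 2 <= cosh t.
Proof.
have := expR_ge1Dx t; have := expR_gt0 (- t).
by rewrite /cosh => ? ?; lra.
Qed.

Lemma cosh_double t : cosh (2 * t) = cosh t ^+ 2 + sinh t ^+ 2.
Proof.
have e1 : expR (2 * t) = expR t ^+ 2 by rewrite mulr_natl mulr2n expRD expr2.
have e2 : expR (- (2 * t)) = expR (- t) ^+ 2.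
  by rewrite -mulrN mulr_natl mulr2n expRD expr2.
by rewrite /cosh /sinh e1 e2; field.
Qed.

End Hyperbolic.
#[local] Existing Instance is_derive_cosh.
#[local] Existing Instance is_derive_sinh.

Lemma is_derive_continuous (R : realType) (f df : R -> R) :
  (forall t : R, is_derive t 1 f (df t)) -> continuous f.
Proof.
move=> dfE t; apply: differentiable_continuous; apply/derivable1_diffP.
by case: (dfE t).
Qed.

Lemma continuous_cosh (R : realType) : continuous (@cosh R).
Proof. exact: is_derive_continuous (@is_derive_cosh R). Qed.

Lemma continuous_sinh (R : realType) : continuous (@sinh R).
Proof. exact: is_derive_continuous (@is_derive_sinh R). Qed.

(** * The logarithmic derivative of K_1 *)

Section BesselRecurrence.
Context (R : realType) (z : R).
Hypothesis z0 : 0 < z.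

Let e (t : R) := expR (- (z * cosh t)).

Let de (t : R) : is_derive t 1 e (- z * sinh t * e t).
Proof. by rewrite /e; apply: is_derive_eq; rewrite /GRing.scale/=; ring. Qed.
Local Existing Instance de.

(** With [y = z * cosh t] the bound is [z^-1 * (y + 1) * e^{-y}], which is at most
    a constant over [y] because [e^y >= 1 + y + y^2/4]; and [y >= z * t / 2]. *)
Lemma expR_cosh_cvg0 (p : R -> R) :
  (forall t, 0 <= t -> `|p t| <= cosh t + z^-1) ->
  (p t * e t) @[t --> +oo%R] --> 0.
Proof.
move=> pub.
have lim0 : (8 / z ^+ 2 * t^-1) @[t --> +oo%R] --> (0 : R).
  rewrite -[X in _ --> X](mulr0 (8 / z ^+ 2)).
  apply: (cvgM (cvg_cst _)).
  by apply/gtr0_cvgV0; [exact: nbhs_pinfty_gt|exact: cvg_id].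
apply: norm_cvg0; apply: squeeze_cvgr (cvg_cst 0) lim0.
near=> t.
have t0 : 0 < t by near: t; exact: nbhs_pinfty_gt.
rewrite normr_ge0/= normrM (ger0_norm (expR_ge0 _)).
apply: le_trans (ler_wpM2r (expR_ge0 _) (pub _ (ltW t0))) _.
set c := cosh t; have c0 : t / 2 <= c := cosh_ge_half t.
have y0 : 0 <= z * c by rewrite mulr_ge0 ?(ltW z0)//; lra.
(* Square the bound 1 + y/2 <= e^{y/2}. *)
have ey : 1 + z * c + (z * c) ^+ 2 / 4 <= expR (z * c).
  have -> : expR (z * c) = expR (z * c / 2) ^+ 2.
    by rewrite expr2 -expRD; congr expR; field.
  have := expR_ge1Dx (z * c / 2); move: y0; set y := z * c => y0 h.
  have -> : 1 + y + y ^+ 2 / 4 = (1 + y / 2) ^+ 2 by field.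
  by rewrite ler_pXn2r// nnegrE; lra.
rewrite expRN ler_pdivrMr ?expR_gt0//.
have zt : 0 < z * t by rewrite mulr_gt0.
have -> : 8 / z ^+ 2 * t^-1 * expR (z * c) = z^-1 * (8 * expR (z * c) / (z * t)).
  by field; rewrite !gt_eqF.
have -> : c + z^-1 = z^-1 * (z * c + 1) by field; rewrite gt_eqF.
apply: ler_wpM2l; first by rewrite invr_ge0 ltW.
rewrite ler_pdivlMr//.
have h : (z * c + 1) * (z * t) <= (z * c + 1) * (2 * (z * c)).
  apply: ler_wpM2l; first lra.
  by rewrite mulrCA ler_pM2l//; lra.
apply: le_trans h _; nra.
Unshelve. all: by end_near. Qed.

(** The identity to be proved is that [sinh * e] has boundary terms 0, hence that
    its derivative [(cosh - z * sinh^2) * e] integrates to 0. This derivative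
    changes sign, whereas the fundamental theorem on a half-line applies to
    functions of constant sign. It is therefore written as [f1 - f2] with [f1] and
    [f2] nonnegative: the primitives [F1 = sinh * e + F2] and
    [F2 = - (cosh + z^-1) * e] have the same value at 0 and vanish at infinity. *)
Let f1 t := (cosh t + z * (sinh t * (cosh t - sinh t))) * e t.
Let F1 t := (sinh t - cosh t - z^-1) * e t.
Let f2 t := z * (sinh t * cosh t) * e t.
Let F2 t := (- cosh t - z^-1) * e t.

Let f1_ge0 t : 0 <= t -> 0 <= f1 t.
Proof.
move=> t0; rewrite mulr_ge0 ?expR_ge0// addr_ge0 ?(ltW (cosh_gt0 _))//.
by rewrite mulr_ge0 ?(ltW z0)// mulr_ge0 ?sinh_ge0// coshB_sinh expR_ge0.
Qed.

Let f2_ge0 t : 0 <= t -> 0 <= f2 t.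
Proof.
move=> t0; rewrite mulr_ge0 ?expR_ge0// mulr_ge0 ?(ltW z0)//.
by rewrite mulr_ge0 ?sinh_ge0// (ltW (cosh_gt0 _)).
Qed.

Let dF1 (t : R) : is_derive t 1 F1 (f1 t).
Proof.
rewrite /F1; apply: is_derive_eq.
by rewrite /f1 /GRing.scale/=; field; rewrite gt_eqF.
Qed.

Let dF2 (t : R) : is_derive t 1 F2 (f2 t).
Proof.
rewrite /F2; apply: is_derive_eq.
by rewrite /f2 /GRing.scale/=; field; rewrite gt_eqF.
Qed.

Let ce : continuous e.
Proof. exact: is_derive_continuous de. Qed.

Let cf1 : continuous f1.
Proof.
move=> t; apply: continuousM (@ce t).
apply: continuousD; first exact: continuous_cosh.
apply: continuousM; first exact: cst_continuous.
apply: continuousM; first exact: continuous_sinh.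
by apply: continuousB; [exact: continuous_cosh|exact: continuous_sinh].
Qed.

Let cf2 : continuous f2.
Proof.
move=> t; apply: continuousM (@ce t).
apply: continuousM; first exact: cst_continuous.
by apply: continuousM; [exact: continuous_sinh|exact: continuous_cosh].
Qed.

Let F1_cvg0 : F1 t @[t --> +oo%R] --> 0.
Proof.
apply: expR_cosh_cvg0 => t t0.
have := coshB_sinh t; have := expR_gt0 (- t); have := sinh_ge0 t0.
have : 0 < z^-1 by rewrite invr_gt0.
by move=> *; rewrite ler_norml; apply/andP; split; lra.
Qed.

Let F2_cvg0 : F2 t @[t --> +oo%R] --> 0.
Proof.
apply: expR_cosh_cvg0 => t t0.
have : 0 < z^-1 by rewrite invr_gt0.
by have := cosh_gt0 t => *; rewrite ler_norml; apply/andP; split; lra.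
Qed.

Let FTC (f F : R -> R) : (forall t, 0 <= t -> 0 <= f t) ->
  continuous f -> (forall t : R, is_derive t 1 F (f t)) ->
  F t @[t --> +oo%R] --> 0 ->
  (\int[lebesgue_measure]_(t in `[0%R, +oo[) (f t)%:E = (- F 0)%:E)%E.
Proof.
move=> f0 cf dF F_cvg0.
rewrite (@ge0_continuous_FTC2y R f F 0 0)//.
- by rewrite -EFinB sub0r.
- exact: continuous_subspaceT.
- by apply: cvg_at_right_filter; exact: (is_derive_continuous dF).
- by move=> t _; rewrite derive1E derive_val.
Qed.

Let FTC_integrable (f F : R -> R) : (forall t, 0 <= t -> 0 <= f t) ->
  continuous f -> (forall t : R, is_derive t 1 F (f t)) ->
  F t @[t --> +oo%R] --> 0 ->
  lebesgue_measure.-integrable `[0%R, +oo[ (EFin \o f).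
Proof.
move=> f0 cf dF F_cvg0; apply/integrableP; split.
  apply/measurable_EFinP; apply: measurable_funTS.
  exact: continuous_measurable_fun.
under eq_integral.
  move=> t; rewrite inE/= in_itv/= andbT => t0.
  rewrite ger0_norm ?f0//; over.
by rewrite (FTC f0 cf dF F_cvg0) ltry.
Qed.

(** The left-hand side is minus the derivative of K_1. Since
    [cosh (2 t) = cosh^2 t + sinh^2 t], it differs from K_2 by the integral of
    [sinh^2 * e], which equals [z^-1 * K_1] by parts. *)
Lemma besselK_recurrence :
  laplace_integrable lebesgue_measure `[0, +oo[%classic cosh (@cosh R) ->
  \int[lebesgue_measure]_(t in `[0, +oo[%classic)
    (cosh t * cosh t * expR (- (z * cosh t))) = besselK 2 z - z^-1 * besselK 1 z.
Proof.
move=> icosh; set D := (X in laplace_integrable _ X _ _) in icosh *.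
have mD : measurable (D : set (g_sigma_algebraType R.-ocitv.-measurable)).
  exact: measurable_itv.
have i1 := icosh z z0.
have i2 : lebesgue_measure.-integrable D
    (EFin \o (fun t => cosh t * cosh t * e t)).
  apply: laplace_integrable_phi icosh z z0.
  - exact: measurable_itv.
  - by move=> t _; exact/ltW/cosh_gt0.
  - apply: measurable_funTS; apply: continuous_measurable_fun.
    exact: continuous_cosh.
have if1 := FTC_integrable f1_ge0 cf1 dF1 F1_cvg0.
have if2 := FTC_integrable f2_ge0 cf2 dF2 F2_cvg0.
have If : \int[lebesgue_measure]_(t in D) f1 t =
          \int[lebesgue_measure]_(t in D) f2 t.
  rewrite /Rintegral (FTC f1_ge0 cf1 dF1 F1_cvg0) (FTC f2_ge0 cf2 dF2 F2_cvg0).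
  by rewrite /F1 /F2 sinh0 sub0r.
have K1 : besselK 1 z = \int[lebesgue_measure]_(t in D) (cosh t * e t).
  by apply: eq_Rintegral => t _; rewrite mul1r.
have if12 : lebesgue_measure.-integrable D (EFin \o (fun t => f1 t - f2 t)).
  exact: (integrableB mD if1 if2).
have i3 : lebesgue_measure.-integrable D
    (EFin \o (fun t => cosh t * e t - (f1 t - f2 t))).
  exact: (integrableB mD i1 if12).
have i4 : lebesgue_measure.-integrable D
    (EFin \o (fun t => z^-1 * (cosh t * e t - (f1 t - f2 t)))).
  exact: (integrableZl mD z^-1 i3).
have -> : besselK 2 z = \int[lebesgue_measure]_(t in D)
    (cosh t * cosh t * e t + z^-1 * (cosh t * e t - (f1 t - f2 t))).
  apply: eq_Rintegral => t _; rewrite cosh_double /f1 /f2 -/(e t).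
  by field; rewrite gt_eqF.
rewrite RintegralD// RintegralZl// RintegralB// RintegralB// If subrr subr0 K1.
by rewrite addrK.
Qed.

End BesselRecurrence.

(** * Polynomials with coefficients depending on a parameter *)

Section CoefwiseDerivative.
Context (R : realType).
Implicit Types (z : R) (Q S : R -> {poly R}).

Lemma is_derive_bigsum (n : nat) (h : 'I_n -> R -> R) (z : R) (dh : 'I_n -> R) :
  (forall i, is_derive z 1 (h i) (dh i)) ->
  is_derive z 1 (fun s => \sum_(i < n) h i s) (\sum_(i < n) dh i).
Proof.
move=> dhE; have := is_derive_sum dhE.
by congr is_derive; apply/funext => s; rewrite fct_sumE.
Qed.

Lemma near_pos z : 0 < z -> \forall s \near z, 0 < s.
Proof.
move=> z0.
have /near_in_itvoy : z \in `]0, +oo[ by rewrite in_itv/= z0.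
by apply: filterS => s; rewrite in_itv/= andbT.
Qed.

(** Coefficientwise derivatives suffice: under a degree bound uniform in the
    parameter, evaluations and linear functionals are finite linear combinations
    of the coefficients. *)
Definition poly_is_derive z Q (dQ : {poly R}) : Prop :=
  forall i, is_derive z 1 (fun s => (Q s)`_i) dQ`_i.

Lemma poly_is_deriveM z Q S dQ dS :
  poly_is_derive z Q dQ -> poly_is_derive z S dS ->
  poly_is_derive z (fun s => Q s * S s) (dQ * S z + Q z * dS).
Proof.
move=> hQ hS i.
have -> : (fun s => (Q s * S s)`_i) =
    (fun s => \sum_(j < i.+1) (Q s)`_j * (S s)`_(i - j)).
  by apply/funext => s; rewrite coefM.
rewrite coefD !coefM -big_split/=.
apply: is_derive_bigsum => j.
have := is_deriveM (hQ j) (hS (i - j)%N).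
by congr is_derive; rewrite /GRing.scale/=; ring.
Qed.

Lemma poly_is_deriveXn z Q dQ n :
  poly_is_derive z Q dQ -> poly_is_derive z (fun s => 'X^n * Q s) ('X^n * dQ).
Proof.
move=> hQ i; rewrite coefXnM; under eq_fun do rewrite coefXnM.
by case: ifP => _; [exact: is_derive_cst|exact: hQ].
Qed.

(** A coefficient of index at least [n] is 0 near [z], so its derivative is 0. *)
Lemma size_poly_is_derive z Q dQ n : 0 < z ->
  (forall s, 0 < s -> (size (Q s) <= n)%N) ->
  poly_is_derive z Q dQ -> (size dQ <= n)%N.
Proof.
move=> z0 sQ hQ; apply/leq_sizeP => i ni.
have h0 : is_derive z 1 (fun s => (Q s)`_i) 0.
  apply: (near_eq_is_derive _ (is_derive_cst 0 z 1)).
  near=> s; have s0 : 0 < s by near: s; exact: near_pos.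
  by rewrite nth_default// (leq_trans (sQ _ s0)).
by rewrite -(@derive_val _ _ _ _ _ _ _ (hQ i)) (@derive_val _ _ _ _ _ _ _ h0).
Unshelve. all: by end_near. Qed.

Lemma derivable_poly_is_derive z Q n : 0 < z ->
  (forall s, 0 < s -> (size (Q s) <= n)%N) ->
  (forall i, derivable (fun s => (Q s)`_i) z 1) ->
  exists dQ, poly_is_derive z Q dQ.
Proof.
move=> z0 sQ dQ; exists (\poly_(i < n) 'D_1 (fun s => (Q s)`_i) z) => i.
rewrite coef_poly; case: ltnP => ni; first exact: derivableP.
apply: (near_eq_is_derive _ (is_derive_cst 0 z 1)).
near=> s; have s0 : 0 < s by near: s; exact: near_pos.
by rewrite nth_default// (leq_trans (sQ _ s0)).
Unshelve. all: by end_near. Qed.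

Lemma is_derive_horner_param z Q dQ n x : 0 < z ->
  (forall s, 0 < s -> (size (Q s) <= n)%N) ->
  poly_is_derive z Q dQ -> is_derive z 1 (fun s => (Q s).[x]) dQ.[x].
Proof.
move=> z0 sQ hQ.
have sdQ := size_poly_is_derive z0 sQ hQ.
rewrite (horner_coef_wide _ sdQ).
have h : is_derive z 1 (fun s => \sum_(i < n) (Q s)`_i * x ^+ i)
    (\sum_(i < n) dQ`_i * x ^+ i).
  apply: is_derive_bigsum => i.
  have := is_deriveM (hQ i) (is_derive_cst (x ^+ i) z 1).
  by congr is_derive; rewrite /GRing.scale/=; ring.
apply: (near_eq_is_derive _ h); near=> s.
have s0 : 0 < s by near: s; exact: near_pos.
by rewrite (horner_coef_wide _ (sQ _ s0)).
Unshelve. all: by end_near. Qed.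

End CoefwiseDerivative.

(** * Orthonormal families of polynomials *)

Section OrthonormalFamily.
Context (R : realType) (L : {poly R} -> R) (P : nat -> {poly R}).
Hypothesis Llin : forall a p q, L (a *: p + q) = a * L p + L q.
Hypothesis sizeP : forall n, size (P n) = n.+1.
Hypothesis orthoP : forall m n, L (P m * P n) = (m == n)%:R.

Lemma functionalD (p q : {poly R}) : L (p + q) = L p + L q.
Proof. by rewrite -[p]scale1r Llin mul1r scale1r. Qed.

Lemma functional0 : L 0 = 0.
Proof. by apply: (addrI (L 0)); rewrite -functionalD !addr0. Qed.

Lemma functionalZ a p : L (a *: p) = a * L p.
Proof. by rewrite -[a *: p]addr0 Llin functional0 addr0. Qed.

Lemma functional_sum n (F : 'I_n -> {poly R}) :
  L (\sum_(i < n) F i) = \sum_(i < n) L (F i).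
Proof.
by elim/big_ind2: _ => [|? ? ? ? <- <-|//]; rewrite ?functional0 ?functionalD.
Qed.

(** Induction on the degree: subtract the multiple of [P n] that cancels the top
    coefficient. The remainder is spanned by lower [P k], hence orthogonal to
    [P n], so that multiple is the Fourier coefficient. *)
Lemma orthonormal_expansion n (p : {poly R}) : (size p <= n)%N ->
  p = \sum_(k < n) L (p * P k) *: P k.
Proof.
elim: n p => [|n IHn] p sp.
  by rewrite big_ord0; apply/eqP; rewrite -size_poly_leq0.
have lcP : (P n)`_n != 0.
  have := lead_coef_eq0 (P n); rewrite /lead_coef sizeP/= => ->.
  by rewrite -size_poly_eq0 sizeP.
pose a := p`_n / (P n)`_n; pose q := p - a *: P n.
have sq : (size q <= n)%N.
  apply/leq_sizeP => i; rewrite leq_eqVlt => /predU1P[<-|ni].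
    by rewrite coefB coefZ /a divfK ?subrr.
  by rewrite coefB coefZ !nth_default ?mulr0 ?subr0// ?sizeP// (leq_trans sp).
have pq : p = q + a *: P n by rewrite subrK.
have Lk k : L (p * P k) = L (q * P k) + a * (n == k)%:R.
  by rewrite pq mulrDl functionalD -scalerAl functionalZ orthoP.
have Lqn : L (q * P n) = 0.
  rewrite (IHn _ sq) mulr_suml functional_sum big1// => k _.
  by rewrite -scalerAl functionalZ orthoP (ltn_eqF (ltn_ord k)) mulr0.
rewrite big_ord_recr/= Lk Lqn eqxx mulr1 add0r {1}pq; congr (_ + _).
rewrite {1}(IHn _ sq); apply: eq_bigr => k _; congr (_ *: _).
by rewrite Lk (gtn_eqF (ltn_ord k)) mulr0 addr0.
Qed.

Lemma orthonormal_low_degree n (q : {poly R}) : (size q <= n)%N -> L (q * P n) = 0.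
Proof.
move=> sq; rewrite (orthonormal_expansion sq) mulr_suml functional_sum big1// => k _.
by rewrite -scalerAl functionalZ orthoP (ltn_eqF (ltn_ord k)) mulr0.
Qed.

Definition gram_schmidt n : {poly R} := 'X^n - \sum_(k < n) L ('X^n * P k) *: P k.

(** Expanding ['X^n] shows that [gram_schmidt n] is a multiple of [P n]. Being
    monic, it is the multiple by the inverse of the leading coefficient, and the
    squared norm of [gram_schmidt n] is the square of this inverse. Positivity of
    the leading coefficient then selects the positive square root. *)
Lemma orthonormal_gram_schmidt n : 0 < lead_coef (P n) ->
  0 < L (gram_schmidt n * gram_schmidt n) /\
  P n = (Num.sqrt (L (gram_schmidt n * gram_schmidt n)))^-1 *: gram_schmidt n.
Proof.
move=> lc0; set Q := gram_schmidt n; set r := L ('X^n * P n).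
have QE : Q = r *: P n.
  have sX : (size ('X^n : {poly R}) <= n.+1)%N by rewrite size_polyXn.
  rewrite /Q /gram_schmidt {1}(orthonormal_expansion sX) big_ord_recr/=.
  by rewrite addrAC subrr add0r.
have lcE : lead_coef (P n) = (P n)`_n by rewrite /lead_coef sizeP.
have Qn : Q`_n = 1.
  rewrite /Q coefB coefXn eqxx coef_sum big1 ?subr0// => k _.
  by rewrite coefZ nth_default ?mulr0// sizeP.
have r1 : r * lead_coef (P n) = 1 by rewrite lcE -coefZ -QE.
have r0 : 0 < r by rewrite -(pmulr_lgt0 _ lc0) r1.
have LQ : L (Q * Q) = r ^+ 2.
  by rewrite QE -scalerAl functionalZ -scalerAr functionalZ orthoP eqxx mulr1 expr2.
rewrite LQ exprn_gt0//; split => //.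
by rewrite sqrtr_sqr gtr0_norm// QE scalerA mulVf ?scale1r// gt_eqF.
Qed.

End OrthonormalFamily.

(** * Orthonormal families of a varying functional *)

Section ParametricFamily.
Context (R : realType) (L : R -> {poly R} -> R) (c : R -> R).
Context (P : R -> nat -> {poly R}).
Hypothesis Llin : forall z : R, 0 < z ->
  forall a p q, L z (a *: p + q) = a * L z p + L z q.
Hypothesis dL : forall (z : R) (p : {poly R}), 0 < z ->
  is_derive z 1 (fun s => L s p) (c z * L z p - L z ('X * p)).
Hypothesis sizeP : forall z : R, 0 < z -> forall n, size (P z n) = n.+1.
Hypothesis leadP : forall z : R, 0 < z -> forall n, 0 < lead_coef (P z n).
Hypothesis orthoP : forall z : R, 0 < z ->
  forall m n, L z (P z m * P z n) = (m == n)%:R.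

(** Leibniz rule for the pairing of a functional and a polynomial that both move
    with the parameter. The degree bound turns [L s (Q s)] into a sum of the
    products [(Q s)`_i * L s 'X^i] over a fixed range. *)
Lemma is_derive_functional (z : R) (Q : R -> {poly R}) dQ n : 0 < z ->
  (forall s, 0 < s -> (size (Q s) <= n)%N) -> poly_is_derive z Q dQ ->
  is_derive z 1 (fun s => L s (Q s)) (L z dQ + c z * L z (Q z) - L z ('X * Q z)).
Proof.
move=> z0 sQ hQ.
have expand (s : R) (p : {poly R}) : 0 < s -> (size p <= n)%N ->
    L s p = \sum_(i < n) p`_i * L s 'X^i.
  move=> s0 sp; have LsD := Llin s0.
  have {1}-> : p = \sum_(i < n) p`_i *: 'X^i.
    rewrite -poly_def; apply/polyP => i; rewrite coef_poly; case: ltnP => // ni.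
    by rewrite nth_default// (leq_trans sp).
  rewrite (functional_sum LsD); apply: eq_bigr => i _.
  exact: functionalZ.
have h : is_derive z 1 (fun s => \sum_(i < n) (Q s)`_i * L s 'X^i)
   (\sum_(i < n) (dQ`_i * L z 'X^i +
      (Q z)`_i * (c z * L z 'X^i - L z ('X * 'X^i)))).
  apply: is_derive_bigsum => i.
  have := is_deriveM (hQ i) (dL 'X^i z0).
  by congr is_derive; rewrite /GRing.scale/=; ring.
have -> : L z dQ + c z * L z (Q z) - L z ('X * Q z) =
   \sum_(i < n) (dQ`_i * L z 'X^i +
      (Q z)`_i * (c z * L z 'X^i - L z ('X * 'X^i))).
  rewrite big_split/= -expand//; last exact: size_poly_is_derive hQ.
  rewrite -addrA; congr (_ + _).
  under eq_bigr do rewrite mulrBr.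
  rewrite sumrB; congr (_ - _).
    rewrite (expand _ _ z0 (sQ _ z0)) mulr_sumr.
    by apply: eq_bigr => i _; rewrite mulrCA.
  have XE : 'X * Q z = \sum_(i < n) (Q z)`_i *: ('X * 'X^i).
    have {1}-> : Q z = \sum_(i < n) (Q z)`_i *: 'X^i.
      rewrite -poly_def; apply/polyP => i; rewrite coef_poly; case: ltnP => // ni.
      by rewrite nth_default// (leq_trans (sQ _ z0)).
    by rewrite mulr_sumr; apply: eq_bigr => i _; rewrite scalerAr.
  rewrite XE (functional_sum (Llin z0)).
  by apply: eq_bigr => i _; rewrite (functionalZ (Llin z0)).
apply: (near_eq_is_derive _ h); near=> s.
have s0 : 0 < s by near: s; exact: near_pos.
by rewrite -expand// sQ.
Unshelve. all: by end_near. Qed.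

(** Strong induction on [n]: the Gram-Schmidt polynomial involves only moments and
    the [P s k] with [k < n]. *)
Lemma derivable_orthonormal_coef (z : R) n i : 0 < z ->
  derivable (fun s => (P s n)`_i) z 1.
Proof.
move=> z0; elim/ltn_ind: n i => n IHn i.
have hP k : (k < n)%N -> exists dP, poly_is_derive z (P ^~ k) dP.
  move=> kn; apply: (@derivable_poly_is_derive _ _ _ k.+1 z0).
    by move=> s s0; rewrite sizeP.
  by move=> j; exact: IHn.
have da k : (k < n)%N -> derivable (fun s => L s ('X^n * P s k)) z 1.
  move=> kn; have [dP hdP] := hP _ kn.
  have sXP (s : R) : 0 < s -> (size ('X^n * P s k)%R <= n + k.+1)%N.
    move=> s0; apply: leq_trans (size_polyMleq _ _) _.
    by rewrite size_polyXn sizeP.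
  by have [] := is_derive_functional z0 sXP (poly_is_deriveXn n hdP).
pose Q s := gram_schmidt (L s) (P s) n.
have dQ j : derivable (fun s => (Q s)`_j) z 1.
  have -> : (fun s => (Q s)`_j) = cst ('X^n`_j) -
      \sum_(k < n) ((fun s => L s ('X^n * P s k)) * (fun s => (P s k)`_j)).
    apply/funext => s; rewrite /Q /gram_schmidt coefB coef_sum !fctE.
    by rewrite fct_sumE; congr (_ - _); apply: eq_bigr => k _; rewrite coefZ.
  apply: derivableB; first exact: derivable_cst.
  apply: derivable_sum => k.
  by apply: derivableM; [exact: da|exact: IHn].
have sQ (s : R) : 0 < s -> (size (Q s) <= n.+1)%N.
  move=> s0; apply: leq_trans (size_polyD _ _) _.
  rewrite size_polyN geq_max size_polyXn leqnn/=.
  apply: leq_trans (size_sum _ _ _) _; apply/bigmax_leqP => k _.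
  by apply: leq_trans (size_scale_leq _ _) _; rewrite sizeP// ltnS ltnW.
have [dQ' hQ] := derivable_poly_is_derive z0 sQ dQ.
have sQQ (s : R) : 0 < s -> (size (Q s * Q s)%R <= (n.+1 + n.+1).-1)%N.
  move=> s0; apply: leq_trans (size_polyMleq _ _) _.
  by rewrite -!subn1 leq_sub2r// leq_add// sQ.
have dN := is_derive_functional z0 sQQ (poly_is_deriveM hQ hQ).
have GS (s : R) (s0 : 0 < s) :=
  orthonormal_gram_schmidt (Llin s0) (sizeP s0) (orthoP s0) (leadP s0 n).
have [N0 _] := GS _ z0.
have dsq := @is_derive1_comp _ _ (fun s => L s (Q s * Q s)) z _ _
  (is_derive1_sqrt N0) dN.
have dinv := @is_deriveV _ (Num.sqrt \o (fun s => L s (Q s * Q s))) z _ 1 _ dsq.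
have sq0 : (Num.sqrt \o (fun s => L s (Q s * Q s))) z != 0.
  by rewrite /= gt_eqF// sqrtr_gt0.
have [dv _] := dinv sq0.
have dm := derivableM dv (dQ i).
apply: (near_eq_derivable _ dm); near=> s.
have s0 : 0 < s by near: s; exact: near_pos.
by have [_ ->] := GS _ s0; rewrite coefZ.
Unshelve. all: by end_near. Qed.

(** The derivative of [P s n.+1] is expanded in the family at [z]; its
    coefficients come from differentiating the orthonormality relations. *)
Theorem is_derive_orthonormal (z : R) n x : 0 < z ->
  is_derive z 1 (fun s => (P s n.+1).[x])
   (L z ('X * P z n * P z n.+1) * (P z n).[x]
    - 2^-1 * (c z - L z ('X * P z n.+1 * P z n.+1)) * (P z n.+1).[x]).
Proof.
move=> z0.
have sP m (s : R) : 0 < s -> (size (P s m) <= m.+1)%N by move=> s0; rewrite sizeP.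
have dP m : exists dP, poly_is_derive z (P ^~ m) dP.
  apply: (derivable_poly_is_derive z0 (sP m)) => i.
  exact: derivable_orthonormal_coef.
have [dp hp] := dP n.+1.
have sdp : (size dp <= n.+2)%N := size_poly_is_derive z0 (sP _) hp.
have LD := functionalD (Llin z0).
have low := orthonormal_low_degree (Llin z0) (sizeP z0) (orthoP z0).
(* The derivative at z of the constant L s (P s n.+1 * P s m). *)
have key m dq : poly_is_derive z (P ^~ m) dq ->
    L z (dp * P z m) + L z (P z n.+1 * dq) + c z * (n.+1 == m)%:R
      - L z ('X * P z m * P z n.+1) = 0.
  move=> hq.
  have sM (s : R) : 0 < s -> (size (P s n.+1 * P s m)%R <= (n.+2 + m.+1).-1)%N.
    move=> s0; apply: leq_trans (size_polyMleq _ _) _.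
    by rewrite !sizeP.
  have h := is_derive_functional z0 sM (poly_is_deriveM hp hq).
  have h0 : is_derive z 1 (fun s => L s (P s n.+1 * P s m)) 0.
    apply: (near_eq_is_derive _ (is_derive_cst ((n.+1 == m)%:R : R) z 1)).
    near=> s; have s0 : 0 < s by near: s; exact: near_pos.
    by rewrite orthoP.
  have := @derive_val _ _ _ _ _ _ _ h0.
  rewrite (@derive_val _ _ _ _ _ _ _ h) LD orthoP//.
  by rewrite -mulrA [P z m * _]mulrC.
have dpk m : (m < n)%N -> L z (dp * P z m) = 0.
  move=> mn; have [dq hq] := dP m.
  have := key _ _ hq; rewrite [P z n.+1 * dq]mulrC.
  rewrite (low n.+1 dq); last first.
    by rewrite (leq_trans (size_poly_is_derive z0 (sP _) hq))// ltnW.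
  rewrite (low n.+1 ('X * P z m)); last first.
    by rewrite mulrC size_mulX ?sizeP ?ltnS// -size_poly_gt0 sizeP.
  by rewrite gtn_eqF ?ltnS ?(ltnW mn)// mulr0 subr0 !addr0.
have dpn : L z (dp * P z n) = L z ('X * P z n * P z n.+1).
  have [dq hq] := dP n.
  have := key _ _ hq; rewrite [P z n.+1 * dq]mulrC (low n.+1 dq); last first.
    exact: (size_poly_is_derive z0 (sP _) hq).
  by rewrite gtn_eqF// mulr0 !addr0 => /eqP; rewrite subr_eq0 => /eqP.
have dpn1 : L z (dp * P z n.+1) =
    - (2^-1 * (c z - L z ('X * P z n.+1 * P z n.+1))).
  by have := key _ _ hp; rewrite [P z n.+1 * dp]mulrC eqxx mulr1 => ?; lra.
have := is_derive_horner_param x z0 (sP n.+1) hp.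
congr is_derive.
rewrite (orthonormal_expansion (Llin z0) (sizeP z0) (orthoP z0) sdp).
rewrite !big_ord_recr/= big1 ?add0r; last first.
  by move=> k _; rewrite dpk ?scale0r.
by rewrite hornerD !hornerZ dpn dpn1 mulNr.
Unshelve. all: by end_near. Qed.

End ParametricFamily.

(** * The Bessel weight *)

Section BesselWeight.
Context (R : realType) (l : nat).
Local Notation mu := (@lebesgue_measure R).
Local Notation halfline a := (`[a, +oo[%classic : set R).

Definition gegenbauer_weight (x : R) : R := (x ^+ 2 - 1) `^ (l%:R - 2^-1).

(** [inner l z] of two polynomials depends only on their product
    ([moment_inner]), so it is recorded as a functional of one polynomial. *)
Definition moment (z : R) (p : {poly R}) : R :=
  \int[mu]_(x in halfline 1) (p.[x] * omega l z x).

Lemma moment_inner (z : R) (p q : {poly R}) :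
  inner l z (horner p) (horner q) = moment z (p * q).
Proof. by apply: eq_Rintegral => x _; rewrite hornerM. Qed.

(** If K_1 were 0, its inverse, hence the weight, would be 0 by convention. *)
Lemma moment_besselK_neq0 (z : R) (p : {poly R}) :
  moment z p != 0 -> besselK 1 z != 0.
Proof.
apply: contraNneq => K0; apply/eqP; rewrite /moment.
transitivity (\int[mu]_(x in halfline 1) (0 : R)).
  by apply: eq_Rintegral => x _; rewrite /omega K0 invr0 !mul0r mulr0.
by rewrite /Rintegral integral0.
Qed.

Lemma besselK_gt0 (z : R) : besselK 1 z != 0 -> 0 < besselK 1 z.
Proof.
move=> K0; rewrite lt_neqAle eq_sym K0/= Rintegral_ge0// => t _.
by rewrite mulr_ge0 ?expR_ge0// ltW// cosh_gt0.
Qed.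

Lemma besselK_laplace_integrable : (forall z : R, 0 < z -> besselK 1 z != 0) ->
  laplace_integrable mu (halfline 0) cosh (@cosh R).
Proof.
move=> K0 z z0; apply: Rintegral_neq0_integrable.
- exact: measurable_itv.
- apply: measurable_funTS; apply: continuous_measurable_fun => t.
  apply: continuousM; first exact: continuous_cosh.
  apply: continuous_comp; last exact: continuous_expR.
  apply: continuousN; apply: continuousM; first exact: cst_continuous.
  exact: continuous_cosh.
- by move=> t _; rewrite mulr_ge0 ?expR_ge0// ltW// cosh_gt0.
- have := K0 z z0; rewrite /besselK; congr (_ != _).
  by apply: eq_Rintegral => t _; rewrite mul1r.
Qed.

Lemma is_derive_besselK1 (z : R) : (forall z : R, 0 < z -> besselK 1 z != 0) ->
  0 < z -> is_derive z 1 (@besselK R 1) (- (besselK 2 z - z^-1 * besselK 1 z)).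
Proof.
move=> K0 z0; have ic := besselK_laplace_integrable K0.
rewrite -besselK_recurrence//.
have -> : @besselK R 1 = fun s => \int[mu]_(t in halfline 0)
    (cosh t * expR (- (s * cosh t))).
  by apply/funext => s; apply: eq_Rintegral => t _; rewrite mul1r.
apply: is_derive_laplace => //.
- by move=> t _; exact/ltW/cosh_gt0.
- by apply: measurable_funTS; apply: continuous_measurable_fun;
    exact: continuous_cosh.
Qed.

Lemma measurable_gegenbauer_weight (D : set R) : measurable_fun D gegenbauer_weight.
Proof.
apply: measurable_funTS; rewrite /gegenbauer_weight.
apply: (measurableT_comp (measurable_powR (l%:R - 2^-1))).
by apply: measurable_funB => //; exact: measurable_funX.
Qed.

Lemma continuous_expRNM (z : R) : continuous (fun x : R => expR (- (z * x))).
Proof.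
move=> x; apply: continuous_comp; last exact: continuous_expR.
by apply: continuousN; apply: continuousM; [exact: cst_continuous|].
Qed.

(** Nonvanishing of the moments of positive constants is what normalisation of the
    degree-zero polynomials provides, for every parameter [z]. *)
Lemma weight_laplace_integrable :
  (forall z : R, 0 < z -> exists2 a, 0 < a & moment z a%:P != 0) ->
  laplace_integrable mu (halfline 1) id gegenbauer_weight.
Proof.
move=> m0 z z0; have [a a0 ma] := m0 z z0.
have K0 := besselK_gt0 (moment_besselK_neq0 ma).
have mI : measurable (halfline 1 : set (g_sigma_algebraType R.-ocitv.-measurable)).
  exact: measurable_itv.
have : mu.-integrable (halfline 1) (EFin \o (fun x => a%:P.[x] * omega l z x)).
  apply: Rintegral_neq0_integrable => //.
    apply: measurable_funM.
      apply: measurable_funTS; apply: continuous_measurable_fun.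
      exact: continuous_horner.
    apply: measurable_funM; last first.
      apply: measurable_funTS; apply: continuous_measurable_fun.
      exact: continuous_expRNM.
    by apply: measurable_funM => //; exact: measurable_gegenbauer_weight.
  move=> x _; rewrite hornerC /omega mulr_ge0 ?(ltW a0)// mulr_ge0 ?expR_ge0//.
  by rewrite mulr_ge0 ?powR_ge0// invr_ge0 ltW.
move/(integrableZl mI (besselK 1 z / a)); apply: eq_integrable => // x _.
rewrite /= -EFinM hornerC /omega /gegenbauer_weight; congr EFin.
by field; rewrite !gt_eqF.
Qed.

Section Moments.
Hypothesis K0 : forall z : R, 0 < z -> besselK 1 z != 0.
Hypothesis iw : laplace_integrable mu (halfline 1) id gegenbauer_weight.

Let mI : measurable (halfline 1 : set (g_sigma_algebraType R.-ocitv.-measurable)).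
Proof. exact: measurable_itv. Qed.

Let mid : measurable_fun (halfline 1 : set (g_sigma_algebraType R.-ocitv.-measurable))
  (id : R -> R).
Proof. exact: measurable_id. Qed.

Let id_ge0 (x : R) : halfline 1 x -> 0 <= x.
Proof. by rewrite /= in_itv/= andbT; apply: le_trans. Qed.

Lemma poly_weight_laplace_integrable (p : {poly R}) :
  laplace_integrable mu (halfline 1) id (fun x => p.[x] * gegenbauer_weight x).
Proof.
elim/poly_ind: p => [|p a ip].
  apply: laplace_integrable_eq (laplace_integrableZ mI 0 iw) => // x _.
  by rewrite horner0.
have ipx := laplace_integrable_phi mI id_ge0 mid ip.
apply: laplace_integrable_eq
  (laplace_integrableD mI ipx (laplace_integrableZ mI a iw)) => // x _.
by rewrite /= !hornerE; ring.
Qed.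

Let laplace_poly (p : {poly R}) (z : R) : R :=
  \int[mu]_(x in halfline 1) (p.[x] * gegenbauer_weight x * expR (- (z * x))).

Let moment_laplace (p : {poly R}) (z : R) : 0 < z ->
  moment z p = (besselK 1 z)^-1 * laplace_poly p z.
Proof.
move=> z0; rewrite /laplace_poly -RintegralZl//; last first.
  exact: poly_weight_laplace_integrable.
by apply: eq_Rintegral => x _; rewrite /omega /gegenbauer_weight; ring.
Qed.

Lemma moment_linear (z a : R) (p q : {poly R}) : 0 < z ->
  moment z (a *: p + q) = a * moment z p + moment z q.
Proof.
move=> z0; rewrite !moment_laplace// mulrCA -mulrDr; congr (_ * _).
have ip := poly_weight_laplace_integrable p z0.
rewrite /laplace_poly -RintegralZl// -RintegralD//.
- by apply: eq_Rintegral => x _; rewrite hornerD hornerZ; ring.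
- exact: (integrableZl mI a ip).
- exact: (poly_weight_laplace_integrable q z0).
Qed.

(** The factor [besselG z - z^-1] is the logarithmic derivative of
    [(besselK 1 z)^-1], from [is_derive_besselK1]. *)
Lemma is_derive_moment (z : R) (p : {poly R}) : 0 < z ->
  is_derive z 1 (moment ^~ p)
    ((besselG z - z^-1) * moment z p - moment z ('X * p)).
Proof.
move=> z0.
have Kz := K0 z0.
have dK := is_deriveV Kz (is_derive_besselK1 K0 z0).
have dJ : is_derive z 1 (laplace_poly p) (- laplace_poly ('X * p) z).
  have := is_derive_laplace mI id_ge0 mid z0 (poly_weight_laplace_integrable p).
  congr is_derive; congr (- _); apply: eq_Rintegral => x _.
  by rewrite /= !hornerE; ring.
have := is_deriveM dK dJ.
rewrite (_ : _ *: _ + _ = (besselG z - z^-1) * moment z p - moment z ('X * p)).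
  apply: near_eq_is_derive; near=> s.
  have s0 : 0 < s by near: s; exact: near_pos.
  by rewrite moment_laplace.
rewrite !moment_laplace// /besselG /GRing.scale/=; field.
by rewrite Kz gt_eqF.
Unshelve. all: by end_near. Qed.

End Moments.
End BesselWeight.

Theorem theorem3p3 (R : realType) (l : nat) (hl : l = 0%N \/ l = 1%N)
    (P : R -> nat -> {poly R})
    (hP : forall zeta : R, 0 < zeta -> orthonormal_polys l zeta (P zeta))
    (n : nat) (zeta : R) (hzeta : 0 < zeta) (x : R) :
  is_derive zeta 1 (fun z : R => (P z n.+1).[x])
    (coef_a l zeta (P zeta) n * (P zeta n).[x]
     - 2^-1 * (besselG zeta - zeta^-1 - coef_b l zeta (P zeta) n.+1)
       * (P zeta n.+1).[x]).
Proof.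
have ortho (z : R) : 0 < z -> forall m k, moment l z (P z m * P z k) = (m == k)%:R.
  by move=> z0 m k; have [_ _ <-] := hP z z0; rewrite moment_inner.
have m0 (z : R) : 0 < z -> exists2 a, 0 < a & moment l z a%:P != 0.
  move=> z0; have [sP lP _] := hP z z0.
  have /size_poly1P[a a0 aE] : size (P z 0%N) == 1%N by rewrite sP.
  exists (a * a); first by rewrite -expr2 exprn_even_gt0.
  by rewrite polyCM -aE ortho// eqxx oner_neq0.
have K0 (z : R) : 0 < z -> besselK 1 z != 0.
  by move=> /m0[a _]; exact: moment_besselK_neq0.
have iw := weight_laplace_integrable m0.
have aE : coef_a l zeta (P zeta) n = moment l zeta ('X * P zeta n * P zeta n.+1).
  by apply: eq_Rintegral => y _; rewrite !hornerE.
have bE : coef_b l zeta (P zeta) n.+1 =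
    moment l zeta ('X * P zeta n.+1 * P zeta n.+1).
  by apply: eq_Rintegral => y _; rewrite !hornerE.
rewrite aE bE.
apply: (@is_derive_orthonormal _ (moment l) (fun z => besselG z - z^-1)) => //.
- by move=> z z0 a p q; exact: moment_linear.
- by move=> z p z0; exact: is_derive_moment.
- by move=> z /hP[].
- by move=> z /hP[].
Qed.
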